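(* Let $G$ be a locally compact topological group with Haar measure $\mu$ that acts on $\mathcal X$, let $\pi$ be a $G$-invariant probability measure having a density with respect to a reference measure $\mathfrak m$ on $\mathcal X$, where $\frac{d\,\mathfrak m\circ g^{-1}}{d\mathfrak m}$ exists and equals $1$ for every $g\in G$. Let $P,M$ be Markov kernels on $\mathcal X$ admitting a transition density with respect to $\mathfrak m$ at every starting state $x$, and let $\nu$ be a probability measure on $G\times G$. Then $$D^\pi_{KL}(P\|M)=D^\pi_{KL}(P\|\overline P)+D^\pi_{KL}(\overline P\|M),\quad M\in\mathcal L(G,G^{-1}),$$ $$D^\pi_{KL}(P\|M)=D^\pi_{KL}(P\|P_{la})+D^\pi_{KL}(P_{la}\|M),\quad M\in\mathcal{LI}(G),$$ $$D^\pi_{KL}(P\|M)=D^\pi_{KL}(P\|P_{ra})+D^\pi_{KL}(P_{ra}\|M),\quad M\in\mathcal{RI}(G),$$ $$D^\pi_{KL}(P\|M)=D^\pi_{KL}(P\|(P_{la})_{ra})+D^\pi_{KL}((P_{la})_{ra}\|M),\quad M\in\mathcal{LI}(G)\cap\mathcal{RI}(G),$$ $$D^\pi_{KL}(P_{da}\|M)=D^\pi_{KL}(P_{da}\|(P_{la})_{ra})+D^\pi_{KL}((P_{la})_{ra}\|M),\quad M\in\mathcal{LI}(G)\cap\mathcal{RI}(G),$$ where $P_{da}=P_{da}(G,\nu)$. If $G$ is further assumed to be Abelian, then $$D^\pi_{KL}(P\|M)=D^\pi_{KL}(P\|\widetilde P)+D^\pi_{KL}(\widetilde P\|M),\quad M\in\mathcal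 L(G,G).$$
   Context: $\mathcal X$ is a Polish space with its $\sigma$-algebra $\mathcal F$; $G$ acts measurably on it; $\mu$ is normalized to be a probability measure. $\pi$ is $G$-invariant if $\pi(gA)=\pi(A)$ for all $g\in G,A\in\mathcal F$. $U_g[f](x)=f(gx)$ and a Markov kernel $P$ acts by $P[f](x)=\int f(y)P(x,dy)$, so $(U_gPU_h)(x,A)=P(gx,h^{-1}A)$. Averages: $\overline P=\mathbb E_{g\sim\mu}(U_gPU_g^{-1})$, $\widetilde P=\mathbb E_{g\sim\mu}(U_gPU_g)$, $P_{la}=\mathbb E_{g\sim\mu}(U_gP)$, $P_{ra}=\mathbb E_{g\sim\mu}(PU_g)$, $(P_{la})_{ra}=\mathbb E_{(g,h)\sim\mu\otimes\mu}(U_gPU_h)$, $P_{da}(G,\nu)=\mathbb E_{(g,h)\sim\nu}(U_gPU_h)$. Sets of Markov kernels $K$ on $\mathcal X$: $\mathcal L(G,G^{-1})$: $K=U_gKU_g^{-1}$ for all $g\in G$; $\mathcal L(G,G)$: $K=U_gKU_g$ for all $g\in G$; $\mathcal{LI}(G)$: $K=U_gK$ for all $g\in G$; $\mathcal{RI}(G)$: $K=KU_g$ for all $g\in G$. The $\pi$-weighted KL divergence is $D_{KL}^\pi(P\|M)=\int\pi(dx)\int P(x,dy)\log\frac{dP(x,\cdot)}{dM(x,\cdot)}(y)$ if $P(x,\cdot)\ll M(x,\cdot)$ for $\pi$-a.e. $x$, and $+\infty$ otherwise. *)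

(* Defs.v *)
From HB Require Import structures.
From mathcomp Require Import all_boot all_order all_algebra.
From mathcomp Require Import all_classical all_reals all_analysis.
From mathcomp Require Import measurable_realfun.

Set Implicit Arguments.
Unset Strict Implicit.
Unset Printing Implicit Defensive.
Import Order.TTheory GRing.Theory Num.Theory.

Local Open Scope classical_set_scope.
Local Open Scope ring_scope.
Local Open Scope ereal_scope.
Local Open Scope charge_scope.

Notation borel T := (g_sigma_algebraType (@open T)).

(* [borel X] requires a pointed type; the distinguished point plays no role. *)
HB.mixin Record isTopologicalGroup G & PointedTopological G & Group G := {
  continuous_mulg : continuous (fun gh : G * G => (gh.1 * gh.2)%g : G) ;
  continuous_invg : continuous (fun g : G => g^-1%g : G) }.

#[short(type="topologicalGroupType")]
HB.structure Definition TopologicalGroup :=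
  {G of PointedTopological G & Group G & isTopologicalGroup G}.

(* The complete metric is the one carried by [X]; only the topology it induces
   matters. *)
Definition polish_space (R : realType) (X : completePseudoMetricType R) : Prop :=
  hausdorff_space X /\ exists2 D : set X, countable D & dense D.

(* Left Haar measures: nonzero left-invariant Radon measures. *)
Record haar_measure (R : realType) (G : topologicalGroupType)
    (mu : {measure set borel G -> \bar R}) : Prop := HaarMeasure {
  haar_neq0 : mu [set: G] <> 0 ;
  haar_compact : forall K : set G, compact K -> mu K < +oo ;
  haar_outer : forall A : set (borel G), measurable A ->
    mu A = ereal_inf [set mu U | U in [set U : set G | open U /\ A `<=` U]] ;
  haar_inner : forall U : set G, open U ->
    mu U = ereal_sup [set mu K | K in [set K : set G | compact K /\ K `<=` U]] ;
  haar_mulg : forall (g : G) (A : set (borel G)), measurable A ->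
    mu [set (g * x)%g | x in A] = mu A }.

Record measurable_action d (G : topologicalGroupType) (X : measurableType d) :=
  MeasurableAction {
    act :> G -> X -> X ;
    act1 : forall x, act 1%g x = x ;
    actM : forall g h x, act (g * h)%g x = act g (act h x) ;
    measurable_act :
      measurable_fun [set: borel G * X] (fun gx => act gx.1 gx.2) }.

Section translate.
Context d (G : topologicalGroupType) (X : measurableType d).
Variable a : measurable_action G X.
Implicit Types (g h : G) (A : set X).

Definition translate g A : set X := a g @` A.

Lemma translateVE g A : translate g^-1%g A = a g @^-1` A.
Proof.
apply/seteqP; split=> [_ [y Ay <-] | x Ax] /=; first by rewrite -actM mulgV act1.
by exists (a g x) => //; rewrite -actM mulVg act1.
Qed.

Lemma translate1 A : translate 1%g A = A.
Proof. by rewrite -[1%g in LHS]invg1 translateVE; apply/seteqP; split=> x /=; rewrite act1. Qed.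

End translate.

Definition invariant_measure d (G : topologicalGroupType) (X : measurableType d)
    (R : realType) (a : measurable_action G X) (pi : set X -> \bar R) : Prop :=
  forall (g : G) (A : set X), measurable A -> pi (translate a g A) = pi A.

Definition is_density d (X : measurableType d) (R : realType)
    (rho m : set X -> \bar R) (f : X -> \bar R) : Prop :=
  [/\ measurable_fun [set: X] f, forall x, 0 <= f x &
      forall A, measurable A -> rho A = \int[m]_(x in A) f x].

(* [twist a K g h x A] is (U_g K U_h)(x, A) = K(gx, h^-1 A). *)
Definition twist d (G : topologicalGroupType) (X : measurableType d)
    (R : realType) (a : measurable_action G X) (K : X -> {measure set X -> \bar R})
    (g h : G) : X -> set X -> \bar R :=
  fun x A => K (a g x) (translate a h^-1%g A).

Section average.
Context d d' (G : topologicalGroupType) (X : measurableType d)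
  (W : measurableType d') (R : realType).
Variables (a : measurable_action G X) (rho : probability W R).
Variables (u v : W -> borel G).
Hypotheses (u_meas : measurable_fun [set: W] u) (v_meas : measurable_fun [set: W] v).
Variable P : R.-pker X ~> X.

Let measurable_actl g : measurable_fun [set: X] (a g).
Proof.
have -> : a g = (fun gx : borel G * X => a gx.1 gx.2) \o (fun x => (g, x)).
  by [].
exact: measurableT_comp (measurable_act a) (measurable_pair1 _).
Qed.

Let measurable_actlr f g (mf : measurable_fun [set: W * X] f)
    (mg : measurable_fun [set: W * X] g) :
  measurable_fun [set: W * X] (fun z => a (f z : borel G) (g z)).
Proof.
exact: (measurableT_comp (measurable_act a) (measurable_fun_pair mf mg)).
Qed.

Let measurable_translateV g A : measurable A -> measurable (translate a g^-1%g A).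
Proof.
move=> mA; rewrite translateVE -[X in measurable X]setTI.
exact: measurable_actl.
Qed.

Let shift (z : W * X) : {measure set X -> \bar R} := P (a (u z.1) z.2).

Let measurable_shift U : measurable U ->
  measurable_fun [set: W * X] (shift ^~ U).
Proof.
move=> mU; apply: (measurableT_comp (measurable_kernel P U mU)).
by apply: measurable_actlr => //; exact: measurableT_comp u_meas _.
Qed.

HB.instance Definition _ := isKernel.Build _ _ _ _ R shift measurable_shift.

Let shift_setT z : shift z [set: X] = 1.
Proof. exact: prob_kernel. Qed.

HB.instance Definition _ :=
  Kernel_isProbability.Build _ _ _ _ R shift shift_setT.

Let measurable_twist A : measurable A ->
  measurable_fun [set: W * X] (fun z => twist a P (u z.1) (v z.1) z.2 A).
Proof.
move=> mA; pose E := [set q : (W * X) * X | A (a (v q.1.1) q.2)].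
have mE : measurable E.
  have -> : E = (fun q => a (v q.1.1 : borel G) q.2) @^-1` A.
    by [].
  rewrite -[X in measurable X]setTI.
  have mq : measurable_fun [set: (W * X) * X] (fun q => (v q.1.1 : borel G, q.2)).
    apply: measurable_fun_pair => //; apply: (measurableT_comp v_meas).
    exact: measurableT_comp.
  exact: (measurableT_comp (measurable_act a) mq).
have -> : (fun z => twist a P (u z.1) (v z.1) z.2 A) =
    (fun z => shift z (xsection E z)).
  apply/funext => z; rewrite /twist translateVE /shift; congr (P _ _).
  by apply/seteqP; split=> y; rewrite /xsection/= inE.
by apply: measurable_fun_xsection_finite_kernel; rewrite inE.
Qed.

(* The kernel E_{w ~ rho}(U_(u w) P U_(v w)). *)
Definition average (x : X) (A : set X) : \bar R :=
  \int[rho]_w twist a P (u w) (v w) x A.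

Let average0 x : average x set0 = 0.
Proof.
rewrite /average integral0_eq// => w _.
by rewrite /twist /translate image_set0 measure0.
Qed.

Let average_ge0 x A : 0 <= average x A.
Proof. by apply: integral_ge0 => w _; exact: measure_ge0. Qed.

Let average_semi_sigma_additive x : semi_sigma_additive (average x).
Proof.
move=> F mF tF mUF.
have tw_sum w : twist a P (u w) (v w) x (\bigcup_n F n) =
    \sum_(n <oo) twist a P (u w) (v w) x (F n).
  apply/esym/cvg_lim => //; rewrite /twist translateVE preimage_bigcup.
  under eq_fun do under eq_bigr do rewrite translateVE.
  apply: measure_semi_sigma_additive.
  - by move=> n; rewrite -translateVE; exact: measurable_translateV.
  - apply/trivIsetP => i j _ _ ij; rewrite -preimage_setI.
    by move/trivIsetP : tF => ->//; rewrite preimage_set0.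
  - apply: bigcup_measurable => n _.
    by rewrite -translateVE; exact: measurable_translateV.
have -> : average x (\bigcup_n F n) = \sum_(n <oo) average x (F n).
  rewrite -integral_nneseries//; first by apply: eq_integral => w _; exact: tw_sum.
  by move=> n; exact: (measurableT_comp (measurable_twist (mF n))
      (measurable_pair2 x)).
by apply: is_cvg_nneseries => n _ _; exact: average_ge0.
Qed.

HB.instance Definition _ x := isMeasure.Build _ _ R (average x)
  (average0 x) (average_ge0 x) (@average_semi_sigma_additive x).

Definition average_measure x : {measure set X -> \bar R} := average x.

Let measurable_average A : measurable A ->
  measurable_fun [set: X] (average_measure ^~ A).
Proof.
move=> mA; apply: (@measurable_fun_fubini_tonelli_G _ _ _ _ _ rho _ (measurable_twist mA)).
by move=> z; exact: measure_ge0.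
Qed.

HB.instance Definition _ :=
  isKernel.Build _ _ _ _ R average_measure measurable_average.

Let average_setT x : average_measure x [set: X] = 1.
Proof.
rewrite /average_measure/= /average (eq_integral (cst 1)) => [|w _].
  by rewrite integral_cst// mul1e; exact: probability_setT.
by rewrite /twist translateVE preimage_setT prob_kernel.
Qed.

HB.instance Definition _ :=
  Kernel_isProbability.Build _ _ _ _ R average_measure average_setT.

Definition average_kernel : R.-pker X ~> X := average_measure.

End average.

Section group_averages.
Context d (G : topologicalGroupType) (X : measurableType d) (R : realType).
Variable a : measurable_action G X.

Lemma measurable_invg : measurable_fun [set: borel G] (fun g : G => g^-1%g : borel G).
Proof.
apply: measurability => // _ [U oU <-]; rewrite setTI.
by apply: sub_sigma_algebra; apply: open_comp oU => g _; exact: continuous_invg.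
Qed.

Section haar_averages.
Variables (mu : probability (borel G) R) (P : R.-pker X ~> X).

(* E_(g ~ mu) (U_g P U_g^-1), using U_g^-1 = U_(g^-1) *)
Definition bar_average : R.-pker X ~> X :=
  average_kernel a mu (@measurable_id _ (borel G) [set: borel G])
    measurable_invg P.

(* E_(g ~ mu) (U_g P U_g) *)
Definition tilde_average : R.-pker X ~> X :=
  average_kernel a mu (@measurable_id _ (borel G) [set: borel G])
    (@measurable_id _ (borel G) [set: borel G]) P.

(* E_(g ~ mu) (U_g P U_1), where U_1 is the identity *)
Definition left_average : R.-pker X ~> X :=
  average_kernel a mu (@measurable_id _ (borel G) [set: borel G])
    (@measurable_cst _ _ (borel G) (borel G) [set: borel G] 1%g) P.

(* E_(g ~ mu) (U_1 P U_g) *)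
Definition right_average : R.-pker X ~> X :=
  average_kernel a mu
    (@measurable_cst _ _ (borel G) (borel G) [set: borel G] 1%g)
    (@measurable_id _ (borel G) [set: borel G]) P.

Lemma bar_averageE x A :
  bar_average x A = \int[mu]_g P (a g x) (translate a g A).
Proof. by apply: eq_integral => g _; rewrite /twist invgK. Qed.

Lemma tilde_averageE x A :
  tilde_average x A = \int[mu]_g P (a g x) (translate a g^-1%g A).
Proof. by []. Qed.

Lemma left_averageE x A : left_average x A = \int[mu]_g P (a g x) A.
Proof. by apply: eq_integral => g _; rewrite /twist invg1 translate1. Qed.

Lemma right_averageE x A :
  right_average x A = \int[mu]_g P x (translate a g^-1%g A).
Proof. by apply: eq_integral => g _; rewrite /twist act1. Qed.

End haar_averages.

(* E_((g, h) ~ nu) (U_g P U_h) *)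
Definition double_average (nu : probability (borel G * borel G)%type R)
    (P : R.-pker X ~> X) : R.-pker X ~> X :=
  average_kernel a nu (@measurable_fst _ _ (borel G) (borel G))
    (@measurable_snd _ _ (borel G) (borel G)) P.

Lemma double_averageE nu P x A : double_average nu P x A =
  \int[nu]_gh P (a gh.1 x) (translate a gh.2^-1%g A).
Proof. by []. Qed.

Definition left_right_average (mu : probability (borel G) R)
    (P : R.-pker X ~> X) : R.-pker X ~> X :=
  double_average (mu \x mu) P.

End group_averages.

Section invariance_classes.
Context d (G : topologicalGroupType) (X : measurableType d) (R : realType).
Variables (a : measurable_action G X) (K : R.-pker X ~> X).

(* K = U_(u g) K U_(v g) for all g. Kernels are compared on measurable sets:
   the value of a measure outside the sigma-algebra carries no information. *)
Definition fixed_by (u v : G -> G) : Prop :=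
  forall (g : G) (x : X) (A : set X), measurable A ->
    K x A = twist a K (u g) (v g) x A.

(* L(G, G^-1), L(G, G), LI(G) and RI(G), in this order. *)
Definition conj_invariant : Prop := fixed_by id (fun g => g^-1%g).
Definition diag_invariant : Prop := fixed_by id id.
Definition left_invariant : Prop := fixed_by id (fun=> 1%g).
Definition right_invariant : Prop := fixed_by (fun=> 1%g) id.

End invariance_classes.

(* The measure K(x, .), bundled as a probability for the Radon-Nikodym
   derivative. *)
Section kernel_at.
Context d (X : measurableType d) (R : realType) (K : R.-pker X ~> X) (x : X).

Definition kernel_at : set X -> \bar R := K x.

HB.instance Definition _ := Measure.on kernel_at.

Let kernel_at_setT : kernel_at [set: X] = 1.
Proof. exact: prob_kernel. Qed.

HB.instance Definition _ :=
  Measure_isProbability.Build _ _ _ kernel_at kernel_at_setT.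

End kernel_at.

Definition kl_divergence d (X : measurableType d) (R : realType)
    (pi : probability X R) (P M : R.-pker X ~> X) : \bar R :=
  if `[< {ae pi, forall x, P x `<< M x} >] then
    \int[pi]_x \int[P x]_y
      lne (('d (charge_of_finite_measure (kernel_at P x)) '/d (kernel_at M x)) y)
  else +oo.

(* Main.v *)
From HB Require Import structures.
Require Import Defs.
From mathcomp Require Import all_boot all_order all_algebra.
From mathcomp Require Import all_classical all_reals all_analysis.
From mathcomp Require Import measurable_realfun.
Import Order.TTheory GRing.Theory Num.Theory.
Local Open Scope classical_set_scope.
Local Open Scope ring_scope.
Local Open Scope ereal_scope.
Local Open Scope charge_scope.

(** All six identities are one Pythagorean identity.  To a kernel [K] attach the
    law [joint pi K] on [X * X] of a starting point drawn from [pi] followed by a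
    step of [K].  The divergence [kl_divergence pi P M] is then the relative
    entropy of [joint pi P] with respect to [joint pi M]
    ([kl_divergence_joint]): the density of the joint laws disintegrates into
    the densities of [P x] with respect to [M x], because the Borel sets of a
    Polish space have a countable pi-system of generators.

    Let [Q] be the average of the twists [U_(u w) P U_(v w)] over a probability
    on the parameters [w].  Since [pi] is invariant, twisting [K] amounts to
    transporting [joint pi K] by the bijection [shear (u w) (v w)].  Hence
    [joint pi Q] is an average of transported copies of [joint pi P], and when
    [Q] and [M] are fixed by all these twists the transports preserve
    [joint pi Q] and [joint pi M], therefore also the density [q] of the former
    with respect to the latter.  The function [ln q] being invariant, its
    integral against [joint pi P] equals its integral against [joint pi Q]
    ([mixture_law]), and integrating
      ln (dP/dM) = ln (dP/dQ) + ln (dQ/dM)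
    against [joint pi P] yields the identity ([lne_rn_chain],
    [kl_divergence_average]).  The integrals make sense although the logarithms
    need not be integrable, as their negative parts always are
    ([lne_rn_neg_fin]).

    It remains to see that the Haar averages are fixed by the twists.  This
    takes the right invariance of [mu] in some cases, which for a left invariant
    probability follows from Fubini's theorem applied to functions that factor
    through the action ([haar_integral_mulgr]).  For [double_average], the
    average over both sides of [P] is also that of [double_average a nu P]
    ([left_right_average_double]). *)

Set Implicit Arguments.
Unset Strict Implicit.
Unset Printing Implicit Defensive.

(* a representative of the density that is nonnegative everywhere, whereas
   'd p '/d m is so only almost everywhere *)
Local Notation rn := Radon_Nikodym_SigmaFinite.f.

(** * Integrals of extended real functions *)

Section extended_integrals.
Context d (T : measurableType d) (R : realType).
Variable mu : {measure set T -> \bar R}.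
Implicit Types f g : T -> \bar R.

Import HBNNSimple.

Let le_integral_ae f g : (forall x, 0 <= f x) -> (forall x, 0 <= g x) ->
  {ae mu, forall x, f x = g x} -> \int[mu]_x f x <= \int[mu]_x g x.
Proof.
move=> f0 g0 [N [mN N0 fgN]].
have mNC : measurable (~` N) by exact: measurableC.
rewrite [leLHS]ge0_integralTE// [leRHS]ge0_integralTE//.
apply: ge_ereal_sup => _ [h /= hf <-].
pose k := proj_nnsfun h mNC.
apply: ereal_sup_ubound; exists k => /=.
  move=> x; rewrite /= mindicE; have [xN|xN] := boolP (x \in ~` N).
    rewrite mulr1 (le_trans (hf x))//.
    suff -> : f x = g x by [].
    by apply: contrapT => fgx; move: xN; rewrite inE; apply; exact: fgN.
  by rewrite mulr0.
have sE (l : {nnsfun T >-> R}) : sintegral mu l = \int[mu]_x (l x)%:E.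
  by rewrite integral_nnsfun// patch_setT.
rewrite sE [RHS]sE.
apply: ge0_ae_eq_integral => //.
- exact/measurable_EFinP.
- exact/measurable_EFinP.
- by move=> x _; rewrite lee_fin.
- by move=> x _; rewrite lee_fin.
exists N; split => // x /=; apply: contra_notP => xN _.
by rewrite /= mindicE mem_set// mulr1.
Qed.

(** The integral of a nonnegative function is a supremum over the simple
    functions below it, and a simple function keeps its integral when it is
    restricted to the complement of a null set.  The lemma serves for
    [x |-> KL (P x) (M x)], whose measurability is unclear, the Radon-Nikodym
    derivatives being chosen separately at each [x]. *)
Lemma ae_eq_lower_integral f g :
  {ae mu, forall x, f x = g x} -> \int[mu]_x f x = \int[mu]_x g x.
Proof.
move=> fg; rewrite integralE [RHS]integralE.
by congr (_ - _); apply/eqP; rewrite eq_le; apply/andP; split;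
  apply: le_integral_ae => //; near=> x; rewrite ?funeposE ?funenegE (near fg).
Unshelve. all: by end_near. Qed.

(** With [h = f - g] the identity [h^\+ + g = h^\- + f] survives all infinite
    values, because [+oo - +oo] is [-oo]; integrating it and cancelling the
    finite integrals of [g] and [h^\-] gives the claim. *)
Lemma ge0_integralB f g : (forall x, 0 <= f x) -> (forall x, 0 <= g x) ->
  measurable_fun setT f -> measurable_fun setT g -> \int[mu]_x g x < +oo ->
  \int[mu]_x (f x - g x) = \int[mu]_x f x - \int[mu]_x g x.
Proof.
move=> f0 g0 mf mg goo; pose h x := f x - g x.
have mh : measurable_fun setT h by exact: emeasurable_funB.
have hg x : h^\- x <= g x.
  rewrite funenegE /h ge_max g0 andbT.
  move: (f0 x) (g0 x); case: (f x) (g x) => [r| |] [s| |]//= r0 s0; rewrite ?leey ?leNye//.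
  by rewrite lee_fin opprB lerBlDr lerDl -lee_fin.
have hE : forall x, h^\+ x + g x = h^\- x + f x.
  move=> x; rewrite funenegE funeposE /h.
  move: (f0 x) (g0 x); case: (f x) (g x) => [r| |] [s| |]//= r0 s0.
  - rewrite -EFin_max -EFin_max -!EFinD; congr EFin; rewrite opprB.
    have [rs|/ltW rs] := leP r s.
      by rewrite max_r ?subr_le0// max_l ?subr_ge0// add0r subrK.
    by rewrite max_l ?subr_ge0// max_r ?subr_le0// subrK add0r.
  - by rewrite maxNye maxye.
  - by rewrite maxye maxNye.
  - by rewrite maxNye maxye.
have hnoo : \int[mu]_x h^\- x < +oo.
  apply: le_lt_trans goo; apply: ge0_le_integral => //.
  exact: measurable_funeneg.
have : \int[mu]_x h^\+ x + \int[mu]_x g x = \int[mu]_x h^\- x + \int[mu]_x f x.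
  rewrite -ge0_integralD//; last exact: measurable_funepos.
  rewrite -ge0_integralD//; last exact: measurable_funeneg.
  by apply: eq_integral => x _; exact: hE.
rewrite [X in _ -> X = _]integralE.
have : 0 <= \int[mu]_x h^\- x by exact: integral_ge0.
have : 0 <= \int[mu]_x g x by exact: integral_ge0.
move: hnoo goo.
case: (\int[mu]_x h^\- x) => // a _; case: (\int[mu]_x g x) => // b _ _ _.
have : 0 <= \int[mu]_x h^\+ x by exact: integral_ge0.
case: (\int[mu]_x h^\+ x) => // [c _|_]; case: (\int[mu]_x f x) => //= e.
by rewrite -!EFinD => -[H]; congr EFin; apply/eqP; rewrite subr_eq addrAC eq_sym subr_eq (addrC e) -H.
Qed.

(** Additivity when only the negative parts are known to be integrable: this
    is the natural class for logarithms of densities, whose positive parts may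
    have infinite integral. *)
Lemma integralD_fin_neg f g : measurable_fun setT f -> measurable_fun setT g ->
  \int[mu]_x f^\- x < +oo -> \int[mu]_x g^\- x < +oo ->
  \int[mu]_x (f x + g x) = \int[mu]_x f x + \int[mu]_x g x.
Proof.
move=> mf mg foo goo.
have mfp := measurable_funepos mf; have mfn := measurable_funeneg mf.
have mgp := measurable_funepos mg; have mgn := measurable_funeneg mg.
have -> : (fun x => f x + g x) =
    (fun x => (f^\+ x + g^\+ x) - (f^\- x + g^\- x)).
  exact: funeD_posD.
rewrite ge0_integralB.
- rewrite !ge0_integralD// [in RHS]integralE [X in _ = _ + X]integralE.
  have : 0 <= \int[mu]_x f^\- x by exact: integral_ge0.
  have : 0 <= \int[mu]_x g^\- x by exact: integral_ge0.
  move: foo goo; case: (\int[mu]_x f^\- x) => // a _; case: (\int[mu]_x g^\- x) => // b _ _ _.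
  by rewrite -EFinD EFinD fin_num_oppeD// addeACA.
- by move=> x; rewrite adde_ge0.
- by move=> x; rewrite adde_ge0.
- exact: emeasurable_funD.
- exact: emeasurable_funD.
- by rewrite ge0_integralD// lte_add_pinfty.
Qed.

End extended_integrals.

Lemma measurable_lne (R : realType) : measurable_fun [set: \bar R] (@lne R).
Proof.
apply: (measurability _ (ErealGenOInfty.measurableE R)) => _ /= -[_ [r ->] <-].
have lneE (x : \bar R) : (r%:E < lne x) = ((expR r)%:E < x).
  case: x => [x| |]//=; last by rewrite !ltry.
  case: ifPn => [x0|]; last by rewrite -ltNge => x0; rewrite !lte_fin -ltr_expR lnK.
  by rewrite ltNge leNye/= lte_fin ltNge (le_trans x0)// expR_ge0.
rewrite setTI (_ : _ @^-1` _ = `](expR r)%:E, +oo[%classic).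
  exact: emeasurable_itv.
by apply/seteqP; split => x /=; rewrite !in_itv/= !andbT lneE.
Qed.

(** * Relative entropy of an average *)

Section almost_everywhere.
Context d (T : measurableType d) (R : realType).
Implicit Types p q : {measure set T -> \bar R}.

Lemma null_dominates_ae p q (P : T -> Prop) :
  p `<< q -> {ae q, forall x, P x} -> {ae p, forall x, P x}.
Proof.
move=> /null_content_dominatesP pq [A [mA A0 PA]]; exists A; split => //.
exact: pq.
Qed.

Lemma ae_measure_eq p (A B : set T) : measurable A -> measurable B ->
  {ae p, forall x, A x <-> B x} -> p A = p B.
Proof.
move=> mA mB AB; rewrite -(setIT A) -(setIT B) -!integral_indic//.
apply: ge0_ae_eq_integral => //; try by move=> x _; rewrite lee_fin.
- exact/measurable_EFinP.
- exact/measurable_EFinP.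
apply: filterS AB => x AB _; rewrite !indicE.
suff -> : (x \in A) = (x \in B) by [].
by apply/idP/idP; rewrite !inE; apply AB.
Qed.

End almost_everywhere.

Section relative_entropy.
Context d (T : measurableType d) (R : realType).
Implicit Types p q m : probability T R.

Lemma measurable_rn p m : p `<< m -> measurable_fun setT (rn p m).
Proof.
by move=> pm; exact: measurable_int (Radon_Nikodym_SigmaFinite.f_integrable pm).
Qed.

Lemma measurable_lne_rn p m : p `<< m ->
  measurable_fun setT (fun x => lne (rn p m x)).
Proof. by move=> pm; exact: (measurableT_comp (@measurable_lne R) (measurable_rn pm)). Qed.

Lemma ae_rn_gt0 p m : p `<< m -> {ae p, forall x, 0 < rn p m x}.
Proof.
move=> pm; have mf := measurable_rn pm.
exists (rn p m @^-1` [set 0]); split.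
- by rewrite -[X in measurable X]setTI; exact: mf.
- rewrite (Radon_Nikodym_SigmaFinite.f_integral pm); last first.
    by rewrite -[X in measurable X]setTI; exact: mf.
  by apply: integral0_eq.
- move=> x /= /negP; rewrite -leNgt => fx0; apply/eqP.
  by rewrite eq_le fx0 Radon_Nikodym_SigmaFinite.f_ge0.
Qed.

(** For [t < 1] this is [t * ln t^-1 <= t * t^-1]. *)
Lemma mul_lneneg_le1 (t : \bar R) : 0 <= t -> t \is a fin_num ->
  (maxe (- lne t) 0) * t <= 1.
Proof.
case: t => [t| |]//; rewrite lee_fin le_eqVlt => /predU1P[<-|t0] _.
  by rewrite mule0.
rewrite lne_EFin// -EFinN -EFin_max -EFinM lee_fin -ler_pdivlMr//.
rewrite div1r ge_max invr_ge0 (ltW t0) andbT -lnV//.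
by rewrite ltW// ln_sublinear// invr_gt0.
Qed.

(** With [t] the density of [p], the integral is that of [t * max (- ln t) 0]
    against [m], and the integrand is bounded. *)
Lemma lne_rn_neg_fin p m : p `<< m ->
  \int[p]_x (fun x => lne (rn p m x))^\- x < +oo.
Proof.
move=> pm; have mf := measurable_lne_rn pm.
rewrite -(Radon_Nikodym_SigmaFinite.change_of_variables pm)//; last first.
  exact: measurable_funeneg.
apply: (@le_lt_trans _ _ (\int[m]_x cst 1 x)).
  apply: ge0_le_integral => //.
  - by move=> x _; rewrite mule_ge0// Radon_Nikodym_SigmaFinite.f_ge0.
  - by apply: emeasurable_funM; [exact: measurable_funeneg|exact: measurable_rn].
  - move=> x _; rewrite funenegE mul_lneneg_le1//.
      exact: Radon_Nikodym_SigmaFinite.f_ge0.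
    exact: Radon_Nikodym_SigmaFinite.f_fin_num.
by rewrite integral_cst// mul1e (le_lt_trans (probability_le1 m _))// ltry.
Qed.

(** The chain rule for densities turns into a sum of logarithms.  The second
    summand is first integrated against [p]; its integral only depends on the
    law of the density [rn q m], which is the same under [p] and [q]. *)
Lemma lne_rn_chain p q m : p `<< q -> q `<< m ->
  (forall B, measurable B -> p (rn q m @^-1` B) = q (rn q m @^-1` B)) ->
  \int[p]_x lne (rn p m x) = \int[p]_x lne (rn p q x) + \int[q]_x lne (rn q m x).
Proof.
move=> pq qm law; have pm := null_dominates_trans pq qm.
have mf := measurable_rn qm; have ml := measurable_lne_rn qm.
have lawT (h : \bar R -> \bar R) : measurable_fun setT h -> (forall t, 0 <= h t) ->
    \int[p]_x h (rn q m x) = \int[q]_x h (rn q m x).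
  move=> mh h0.
  rewrite -[LHS](ge0_integral_pushforward mf p measurableT mh)//.
  rewrite -[RHS](ge0_integral_pushforward mf q measurableT mh)//.
  by apply: eq_measure_integral => B mB _; exact: law.
have mlp : measurable_fun setT ((@lne R) ^\+) by exact/measurable_funepos/measurable_lne.
have mln : measurable_fun setT ((@lne R) ^\-) by exact/measurable_funeneg/measurable_lne.
have negE : \int[p]_x (fun x => lne (rn q m x))^\- x =
    \int[q]_x (fun x => lne (rn q m x))^\- x.
  rewrite -/(@lne R \o rn q m) funeneg_comp.
  exact: (lawT _ mln (@funeneg_ge0 _ _ _)).
have posE : \int[p]_x (fun x => lne (rn q m x))^\+ x =
    \int[q]_x (fun x => lne (rn q m x))^\+ x.
  rewrite -/(@lne R \o rn q m) funepos_comp.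
  exact: (lawT _ mlp (@funepos_ge0 _ _ _)).
have -> : \int[q]_x lne (rn q m x) = \int[p]_x lne (rn q m x).
  by rewrite integralE [RHS]integralE posE negE.
rewrite -integralD_fin_neg//; last 3 first.
- exact: measurable_lne_rn.
- exact: lne_rn_neg_fin.
- by rewrite negE lne_rn_neg_fin.
apply: ae_eq_integral => //.
- exact: measurable_lne_rn.
- by apply: emeasurable_funD => //; exact: measurable_lne_rn.
have chain : {ae p, forall x, rn p m x = rn p q x * rn q m x}.
  apply: (null_dominates_ae pm).
  have := Radon_Nikodym_SigmaFinite.chain_rule pq qm measurableT.
  by apply: filterS => x /(_ I).
have qm0 : {ae p, forall x, 0 < rn q m x}.
  exact: (null_dominates_ae pq (ae_rn_gt0 qm)).
apply: filterS3 chain qm0 (ae_rn_gt0 pq) => x -> h1 h2 _.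
by rewrite lneM// in_itv/= ?leey andbT.
Qed.

End relative_entropy.

(** The probability [q] is the average of the images of [p] under a family of
    automorphisms [S w], each of which preserves both [q] and [m].  The
    automorphisms then preserve the density of [q], so that averaging does not
    change the law of that density. *)
Section mixture.
Context d d' (T : measurableType d) (W : measurableType d') (R : realType).
Variables (rho : probability W R) (p q m : probability T R).
Variables (S S' : W -> T -> T).
Hypotheses (mS : forall w, measurable_fun setT (S w))
  (mS' : forall w, measurable_fun setT (S' w))
  (SK : forall w, cancel (S w) (S' w)).
Hypothesis q_mix : forall A, measurable A -> q A = \int[rho]_w p (S w @^-1` A).
Hypothesis q_inv : forall w A, measurable A -> q (S w @^-1` A) = q A.
Hypothesis m_inv : forall w A, measurable A -> m (S w @^-1` A) = m A.

Let mpre (h : T -> T) A : measurable_fun setT h -> measurable A ->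
  measurable (h @^-1` A).
Proof. by move=> mh mA; rewrite -[X in measurable X]setTI; exact: mh. Qed.

(** Both sides have integral [q A] over every measurable [A]: for the right-hand
    side, write [A] as the preimage of its image under [S w] and change
    variables. *)
Lemma rn_invariant w : q `<< m -> {ae m, forall x, rn q m x = rn q m (S w x)}.
Proof.
move=> qm; have mf := measurable_rn qm.
have : ae_eq m setT (rn q m) (rn q m \o S w).
  apply: integral_ae_eq => //.
  - exact: Radon_Nikodym_SigmaFinite.f_integrable.
  - exact: measurableT_comp.
  move=> A _ mA; rewrite -(Radon_Nikodym_SigmaFinite.f_integral qm mA).
  have AE : A = S w @^-1` (S' w @^-1` A).
    by apply/seteqP; split => x /=; rewrite SK.
  have mB : measurable (S' w @^-1` A) by exact: mpre.
  rewrite [in RHS]AE -(ge0_integral_pushforward (mS w) m mB)//.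
  - rewrite (eq_measure_integral m) => [|C mC _]; last exact: m_inv.
    rewrite -(Radon_Nikodym_SigmaFinite.f_integral qm mB).
    by have := q_inv w mB; rewrite -AE.
  - exact: measurable_funTS.
  - by move=> x _; exact: Radon_Nikodym_SigmaFinite.f_ge0.
by apply: filterS => x /(_ I).
Qed.

Lemma mixture_dominated : p `<< m -> q `<< m.
Proof.
move=> /null_content_dominatesP pm; apply/null_content_dominatesP => A mA mA0.
rewrite q_mix//; apply: integral0_eq => w _.
by apply: pm; [exact: mpre|exact: (etrans (m_inv w mA) mA0)].
Qed.

(** The level set is invariant up to an [m]-null set, hence up to a [p]-null
    set, so every term of the average defining [q] is the same. *)
Lemma mixture_law B : p `<< m -> measurable B ->
  p (rn q m @^-1` B) = q (rn q m @^-1` B).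
Proof.
move=> pm mB; have qm := mixture_dominated pm.
have mf := measurable_rn qm.
have mfB : measurable (rn q m @^-1` B) by rewrite -[X in measurable X]setTI; exact: mf.
rewrite q_mix// (eq_integral (cst (p (rn q m @^-1` B)))) => [|w _].
  rewrite integral_cst// [X in _ = _ * X](_ : _ = 1) ?mule1//.
  exact: probability_setT.
apply: ae_measure_eq => //; first exact: mpre.
by apply: (null_dominates_ae pm); apply: filterS (rn_invariant w qm) => x /= <-.
Qed.

(** On a [q]-null set the density of [q] vanishes [p]-almost everywhere, and by
    [mixture_law] it is [p]-almost everywhere positive. *)
Lemma mixture_dominates : p `<< m -> p `<< q.
Proof.
move=> pm; have qm := mixture_dominated pm; have mf := measurable_rn qm.
apply/null_content_dominatesP => A mA qA0.
have f0 : {ae p, forall x, 0 < rn q m x}.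
  have [N [mN N0 NP]] := ae_rn_gt0 qm.
  exists (rn q m @^-1` [set 0]); split.
  - by rewrite -[X in measurable X]setTI; exact: mf.
  - rewrite mixture_law// (Radon_Nikodym_SigmaFinite.f_integral qm).
      exact: integral0_eq.
    by rewrite -[X in measurable X]setTI; exact: mf.
  - move=> x /= /negP; rewrite -leNgt => fx0; apply/eqP.
    by rewrite eq_le fx0 Radon_Nikodym_SigmaFinite.f_ge0.
have fA : {ae p, forall x, A x -> rn q m x = 0}.
  apply: (null_dominates_ae pm); apply/(ae_eq_integral_abs m mA).
    exact: measurable_funTS.
  transitivity (\int[m]_(x in A) rn q m x); last first.
    exact: (etrans (esym (Radon_Nikodym_SigmaFinite.f_integral qm mA)) qA0).
  apply: eq_integral => x _; rewrite gee0_abs//.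
  exact: Radon_Nikodym_SigmaFinite.f_ge0.
rewrite -(measure0 p); apply: ae_measure_eq => //.
apply: filterS2 f0 fA => x f0 fA; split => // /fA fx; move: f0.
by rewrite fx ltxx.
Qed.

Lemma mixture_lne_rn : p `<< m ->
  \int[p]_x lne (rn p m x) = \int[p]_x lne (rn p q x) + \int[q]_x lne (rn q m x).
Proof.
move=> pm; apply: lne_rn_chain.
- exact: mixture_dominates.
- exact: mixture_dominated.
- by move=> B; exact: mixture_law.
Qed.

End mixture.

(** * Joint law of a starting point and a step *)

(** The law of a pair whose first coordinate is drawn from [pi] and whose second
    coordinate is drawn from [K] started at the first one. *)
Section joint_law.
Context d d' (X : measurableType d) (Y : measurableType d') (R : realType).
Variables (pi : probability X R) (K : R.-pker X ~> Y).

(* [joint] is obtained by composing the constant kernel [pi] with the kernel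
   that sends [x] to the law of the pair (x, y), y drawn from [K x]; the dummy
   point of [unit] is the source of the constant kernel. *)
Let graph (ux : unit * X) (A : set (X * Y)) : \bar R := K ux.2 (xsection A ux.2).

Let graph0 ux : graph ux set0 = 0.
Proof. by rewrite /graph xsection0 measure0. Qed.

Let graph_ge0 ux A : 0 <= graph ux A. Proof. exact: measure_ge0. Qed.

Let graph_semi_sigma_additive ux : semi_sigma_additive (graph ux).
Proof.
move=> F mF tF mUF; rewrite /graph xsection_bigcup.
apply: measure_semi_sigma_additive.
- by move=> n; exact: measurable_xsection.
- exact: trivIset_xsection.
- by rewrite -xsection_bigcup; exact: measurable_xsection.
Qed.

HB.instance Definition _ ux := isMeasure.Build _ _ R (graph ux)
  (graph0 ux) (graph_ge0 ux) (@graph_semi_sigma_additive ux).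

Let graph_kernel : unit * X -> {measure set (X * Y) -> \bar R} := graph.

Let measurable_graph U : measurable U ->
  measurable_fun [set: unit * X] (graph_kernel ^~ U).
Proof.
move=> mU; have mKU : measurable_fun setT (fun x => K x (xsection U x)).
  exact: (measurable_fun_xsection_finite_kernel K (mem_set mU)).
exact: (measurableT_comp mKU measurable_snd).
Qed.

HB.instance Definition _ := isKernel.Build _ _ _ _ R graph_kernel measurable_graph.

Let graph_setT ux : graph_kernel ux [set: X * Y] = 1.
Proof.
rewrite -[LHS]/(K ux.2 (xsection setT ux.2)) (_ : xsection _ _ = setT) ?prob_kernel//.
by apply/seteqP; split => y //= _; rewrite /xsection/= inE.
Qed.

HB.instance Definition _ :=
  Kernel_isProbability.Build _ _ _ _ R graph_kernel graph_setT.

Let base := kprobability (measurable_cst (pi : pprobability X R) (D := [set: unit])).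

Definition joint : set (X * Y) -> \bar R := kcomp base graph_kernel tt.

HB.instance Definition _ := Measure.copy joint (mkcomp base graph_kernel tt).

Lemma jointE A : joint A = \int[pi]_x K x (xsection A x).
Proof. by []. Qed.

Let joint_setT : joint [set: X * Y] = 1.
Proof.
rewrite jointE (eq_integral (cst 1)) => [|x _].
  by rewrite integral_cst// mul1e; exact: probability_setT.
exact: (graph_setT (tt, x)).
Qed.

HB.instance Definition _ :=
  Measure_isProbability.Build _ _ _ joint joint_setT.

Lemma ge0_integral_joint f : (forall z, 0 <= f z) -> measurable_fun setT f ->
  \int[joint]_z f z = \int[pi]_x \int[K x]_y f (x, y).
Proof.
move=> f0 mf; rewrite [LHS](integral_kcomp base graph_kernel tt f0 mf).
apply: eq_integral => x _.
transitivity (\int[pushforward (K x) (pair x)]_z f z).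
  apply: eq_measure_integral => A mA _ /=; rewrite /graph/= /pushforward.
  by congr (K x _); apply/seteqP; split => y; rewrite /xsection/= inE.
by rewrite (ge0_integral_pushforward (measurable_pair1 x)).
Qed.

End joint_law.

(** * Disintegration of densities *)

Section density_measure.
Context d (T : measurableType d) (R : realType).
Variables (mu : {measure set T -> \bar R}) (f : T -> \bar R).
Hypotheses (mf : measurable_fun [set: T] f) (f0 : forall x, 0 <= f x).

Let dens (A : set T) : \bar R := \int[mu]_(x in A) f x.

Let dens0 : dens set0 = 0. Proof. exact: integral_set0. Qed.

Let dens_ge0 A : 0 <= dens A. Proof. exact: integral_ge0. Qed.

HB.instance Definition _ := isMeasure.Build _ _ R dens dens0 dens_ge0
  (@semi_sigma_additive_nng_induced _ _ _ mu _ mf f0).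

Lemma density_unique (F : (set T)^nat) (nu : probability T R) :
    measurable = <<s range F >> -> setI_closed (range F) -> range F setT ->
    (forall n, nu (F n) = \int[mu]_(x in F n) f x) ->
  forall A, measurable A -> nu A = \int[mu]_(x in A) f x.
Proof.
move=> FE FI FT nuF A mA; have [n _ Fn] := FT.
apply: (measure_unique (range F) (fun=> setT) FE FI _ _ nu dens) => //.
- by apply/seteqP; split => // x _; exists 0%N.
- by move=> _ [k _ <-]; exact: nuF.
- by move=> k; rewrite (le_lt_trans (probability_le1 nu _)) ?ltry.
Qed.

End density_measure.

Section disintegration.
Context d (X : measurableType d) (R : realType).
Variables (pi : probability X R) (P M : R.-pker X ~> X).

(** A set is null for the joint law exactly when almost all its sections are
    null. *)
Lemma dominates_joint :
  {ae pi, forall x, P x `<< M x} -> joint pi P `<< joint pi M.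
Proof.
move=> PM; apply/null_content_dominatesP => A mA; rewrite /= !jointE => MA0.
have mK (K : R.-pker X ~> X) : measurable_fun setT (fun x => K x (xsection A x)).
  exact: (measurable_fun_xsection_finite_kernel K (mem_set mA)).
have MA : {ae pi, forall x, M x (xsection A x) = 0}.
  have : ae_eq pi setT (fun x => M x (xsection A x)) (cst 0).
    apply/(ae_eq_integral_abs pi measurableT (mK M)).
    by rewrite -[RHS]MA0; apply: eq_integral => x _; rewrite gee0_abs.
  by apply: filterS => x /(_ I).
rewrite (ae_eq_lower_integral (g := cst 0)) ?integral0//.
apply: filterS2 PM MA => x /null_content_dominatesP PMx MAx.
by apply: PMx => //; exact: measurable_xsection.
Qed.

Hypothesis PM : joint pi P `<< joint pi M.
Let g := rn (joint pi P) (joint pi M).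

Let g0 z : 0 <= g z. Proof. exact: Radon_Nikodym_SigmaFinite.f_ge0. Qed.

Let mg : measurable_fun setT g. Proof. exact: measurable_rn. Qed.

Let mgx x : measurable_fun setT (fun y => g (x, y)).
Proof. exact: (measurableT_comp mg (measurable_pair1 x)). Qed.

(** Rectangles [E `*` B] show that both functions of [x] have the same integral
    over every measurable [E]. *)
Let disintegrate_set B : measurable B ->
  {ae pi, forall x, P x B = \int[M x]_(y in B) g (x, y)}.
Proof.
move=> mB.
pose b x := \int[M x]_(y in B) g (x, y).
have mb : measurable_fun setT b.
  rewrite (_ : b = fun x => \int[M x]_y ((g \_ (setT `*` B)) (x, y))).
    apply: (measurable_fun_integral_finite_kernel (g \_ (setT `*` B)) M).
      by move=> z; exact: erestrict_ge0.
    apply/(measurable_restrictT _ _).1; first exact: measurableX.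
    exact: measurable_funTS.
  apply/funext => x; rewrite /b integral_mkcond; apply: eq_integral => y _.
  rewrite /patch; congr (if _ then _ else _).
  by apply/idP/idP; rewrite !inE/=; [split|case].
have : ae_eq pi setT (fun x => P x B) b.
  apply: integral_ae_eq => //.
    apply: (@le_integrable _ _ _ _ _ measurableT _ (cst 1)).
    - exact: (measurable_kernel P B mB).
    - move=> x _; rewrite gee0_abs// gee0_abs//.
      exact: (probability_le1 (kernel_at P x) mB).
    - exact: (finite_measure_integrable_cst pi 1).
  move=> E _ mE.
  have mEB : measurable (E `*` B) by exact: measurableX.
  transitivity (joint pi P (E `*` B)).
    rewrite jointE [LHS]integral_mkcond; apply: eq_integral => x _.
    rewrite /patch; case: ifPn => xE; first by rewrite in_xsectionX.
    by rewrite notin_xsectionX// measure0.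
  rewrite (Radon_Nikodym_SigmaFinite.f_integral PM mEB) [LHS]integral_mkcond.
  have mgEB : measurable_fun setT (g \_ (E `*` B)).
    exact: ((measurable_restrictT g mEB).1 (measurable_funTS mg)).
  have gEB0 z : 0 <= (g \_ (E `*` B)) z by apply: erestrict_ge0 => ? _; exact: g0.
  rewrite [LHS](ge0_integral_joint pi M gEB0 mgEB)//.
  rewrite [RHS]integral_mkcond; apply: eq_integral => x _.
  rewrite /patch; case: ifPn => xE.
    rewrite /b [RHS]integral_mkcond; apply: eq_integral => y _.
    rewrite /patch; congr (if _ then _ else _).
    by apply/idP/idP; rewrite !inE/=; [case|split => //; exact: set_mem].
  apply: integral0_eq => y _; rewrite ifF//; apply/negbTE; apply: contra xE.
  by rewrite !inE/= => -[].
by apply: filterS => x /(_ I).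
Qed.

Variable F : (set X)^nat.
Hypotheses (FE : measurable = <<s range F >>) (FI : setI_closed (range F))
  (FT : range F setT).

(** The exceptional null set of [disintegrate_set] depends on the set [B];
    a countable pi-system of generators makes it uniform. *)
Lemma joint_disintegration : {ae pi, forall x, forall B, measurable B ->
  P x B = \int[M x]_(y in B) g (x, y)}.
Proof.
have : {ae pi, forall x, forall n, P x (F n) = \int[M x]_(y in F n) g (x, y)}.
  apply: ae_foralln => n; apply: disintegrate_set.
  by rewrite FE; apply: sub_sigma_algebra; exists n.
apply: filterS => x Pn B mB.
exact: (@density_unique _ _ _ (M x) (fun y => g (x, y)) (mgx x) (fun y => g0 (x, y))
  F (kernel_at P x)).
Qed.

Lemma joint_dominates : {ae pi, forall x, P x `<< M x}.
Proof.
apply: filterS joint_disintegration => x Px.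
apply/null_content_dominatesP => B mB MB0; rewrite Px//.
exact: (null_set_integral mB (measurable_funTS (mgx x)) MB0).
Qed.

(** The derivatives taken at each starting point, for which no joint
    measurability is known, agree with the sections of one jointly measurable
    function. *)
Lemma joint_rn : {ae pi, forall x, {ae P x, forall y,
  'd (charge_of_finite_measure (kernel_at P x)) '/d (kernel_at M x) y = g (x, y)}}.
Proof.
apply: filterS2 joint_dominates joint_disintegration => x PMx Px.
apply: (null_dominates_ae PMx).
have PMx' : kernel_at P x `<< kernel_at M x by exact: PMx.
have : ae_eq (kernel_at M x) setT
    ('d (charge_of_finite_measure (kernel_at P x)) '/d (kernel_at M x))
    (fun y => g (x, y)).
  apply: integral_ae_eq => //.
    exact: Radon_Nikodym_integrable.
  move=> B _ mB; rewrite -Radon_Nikodym_integral//.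
  exact: Px.
by apply: filterS => y /(_ I).
Qed.

End disintegration.

(** * The divergence of kernels and averages of kernels *)

Section kl_divergence_joint.
Context d (X : measurableType d) (R : realType).
Variables (pi : probability X R) (F : (set X)^nat).
Hypotheses (FE : measurable = <<s range F >>) (FI : setI_closed (range F))
  (FT : range F setT).
Implicit Types P M : R.-pker X ~> X.

(** The joint laws have the same first marginal, so their relative entropy is
    the mean over the starting point of the relative entropies of the steps.
    The finiteness of the negative parts justifies the interchange. *)
Lemma kl_divergence_joint P M : joint pi P `<< joint pi M ->
  kl_divergence pi P M = \int[joint pi P]_z lne (rn (joint pi P) (joint pi M) z).
Proof.
move=> PM; rewrite /kl_divergence asboolT; last exact: (joint_dominates PM FE FI FT).
set g := rn _ _; pose L z := lne (g z).
have mL : measurable_fun setT L by exact: measurable_lne_rn.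
have mLp := measurable_funepos mL; have mLn := measurable_funeneg mL.
pose I h x := \int[P x]_y (h (x, y) : \bar R).
have mI h : (forall z, 0 <= h z) -> measurable_fun setT h -> measurable_fun setT (I h).
  by move=> h0 mh; exact: (measurable_fun_integral_finite_kernel h P).
rewrite (ae_eq_lower_integral (g := fun x => I L^\+ x - I L^\- x)); last first.
  apply: filterS (joint_rn PM FE FI FT) => x dE.
  transitivity (\int[P x]_y L (x, y)).
    by apply: ae_eq_lower_integral; apply: filterS dE => y ->.
  rewrite integralE; congr (_ - _); apply: eq_integral => y _.
    by rewrite !funeposE.
  by rewrite !funenegE.
rewrite ge0_integralB.
- rewrite [RHS]integralE.
  rewrite -(ge0_integral_joint pi P (@funepos_ge0 _ _ L) mLp).
  by rewrite -(ge0_integral_joint pi P (@funeneg_ge0 _ _ L) mLn).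
- by move=> x; exact: integral_ge0.
- by move=> x; exact: integral_ge0.
- exact: mI.
- exact: mI.
- rewrite -(ge0_integral_joint pi P (@funeneg_ge0 _ _ L) mLn).
  exact: lne_rn_neg_fin.
Qed.

Lemma kl_divergence_pinfty P M : ~ joint pi P `<< joint pi M ->
  kl_divergence pi P M = +oo.
Proof.
move=> PM; rewrite /kl_divergence asboolF//.
by move=> h; apply: PM; exact: dominates_joint.
Qed.

Lemma kl_divergence_neqNy P M : kl_divergence pi P M != -oo.
Proof.
have [PM|PM] := pselect (joint pi P `<< joint pi M); last first.
  by rewrite kl_divergence_pinfty.
rewrite kl_divergence_joint// integralE.
have subNy (x y : \bar R) : 0 <= x -> 0 <= y -> y < +oo -> x - y != -oo.
  by case: x => // [x|]; case: y.
by apply: subNy; [exact: integral_ge0|exact: integral_ge0|exact: lne_rn_neg_fin].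
Qed.

End kl_divergence_joint.

Section kernel_reindexing.
Context d d' d2 (X : measurableType d) (Y : measurableType d') (K : measurableType d2)
  (R : realType).
Variables (P : R.-pker X ~> Y) (f : K -> X).
Hypothesis mf : measurable_fun setT f.

Let Pf (k : K) : {measure set Y -> \bar R} := P (f k).

Let measurable_Pf U : measurable U -> measurable_fun setT (Pf ^~ U).
Proof. by move=> mU; exact: (measurableT_comp (measurable_kernel P U mU) mf). Qed.

HB.instance Definition _ := isKernel.Build _ _ _ _ R Pf measurable_Pf.

Let Pf_setT k : Pf k setT = 1. Proof. exact: prob_kernel. Qed.

HB.instance Definition _ := Kernel_isProbability.Build _ _ _ _ R Pf Pf_setT.

Lemma measurable_kernel_xsection (E : set (K * Y)) : measurable E ->
  measurable_fun setT (fun k => P (f k) (xsection E k)).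
Proof. by move=> mE; exact: (measurable_fun_xsection_finite_kernel Pf (mem_set mE)). Qed.

End kernel_reindexing.

Section measurable_actions.
Context d (G : topologicalGroupType) (X : measurableType d) (R : realType).
Variable a : measurable_action G X.

Lemma measurable_act_comp d' (T : measurableType d') (g : T -> borel G) (x : T -> X) :
  measurable_fun setT g -> measurable_fun setT x ->
  measurable_fun setT (fun t => a (g t) (x t)).
Proof.
move=> mg mx; exact: (measurableT_comp (measurable_act a) (measurable_fun_pair mg mx)).
Qed.

Lemma measurable_actl g : measurable_fun setT (a g).
Proof. by apply: (measurable_act_comp (g := fun=> g : borel G)). Qed.

Variables (pi : probability X R) (pi_inv : invariant_measure a pi).

Lemma integral_act g f : (forall x, 0 <= f x) -> measurable_fun setT f ->
  \int[pi]_x f (a g x) = \int[pi]_x f x.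
Proof.
move=> f0 mf.
rewrite -[LHS](ge0_integral_pushforward (measurable_actl g) pi measurableT mf)//.
apply: eq_measure_integral => [|mag A mA _]; first exact: measurable_actl.
by rewrite /= /pushforward -translateVE; exact: pi_inv.
Qed.

(** By invariance of [pi], the map under which the joint law of [pi] and
    [twist a K g h] is the image of the joint law of [pi] and [K]. *)
Definition shear (g h : G) (z : X * X) : X * X := (a g^-1%g z.1, a h z.2).

Lemma measurable_shear g h : measurable_fun setT (shear g h).
Proof.
by apply: measurable_fun_pair; apply: measurableT_comp => //; exact: measurable_actl.
Qed.

Lemma shearK g h : cancel (shear g h) (shear g^-1%g h^-1%g).
Proof. by case=> x y; rewrite /shear /= -!actM invgK mulgV mulVg !act1. Qed.

Lemma joint_shear (K : R.-pker X ~> X) g h E : measurable E ->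
  joint pi K (shear g h @^-1` E) = \int[pi]_x twist a K g h x (xsection E x).
Proof.
move=> mE; rewrite jointE.
have mSE : measurable (shear g h @^-1` E).
  by rewrite -[X in measurable X]setTI; exact: measurable_shear.
rewrite -[LHS](integral_act g)//; last first.
  exact: (measurable_fun_xsection_finite_kernel K (mem_set mSE)).
apply: eq_integral => x _; rewrite /twist translateVE; congr (K _ _).
by apply/seteqP; split => y; rewrite /xsection/= !inE/= /shear/= -actM mulVg act1.
Qed.

Lemma joint_fixed (K : R.-pker X ~> X) g h E :
    (forall x A, measurable A -> K x A = twist a K g h x A) ->
  measurable E -> joint pi K (shear g h @^-1` E) = joint pi K E.
Proof.
move=> Kgh mE; rewrite joint_shear// jointE; apply: eq_integral => x _.
by rewrite -Kgh//; exact: measurable_xsection.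
Qed.

Context d' (W : measurableType d') (rho : probability W R) (u v : W -> borel G).
Hypotheses (u_meas : measurable_fun setT u) (v_meas : measurable_fun setT v).
Variables (P Q M : R.-pker X ~> X).
Hypothesis Q_avg : forall x A, measurable A ->
  Q x A = \int[rho]_w twist a P (u w) (v w) x A.

(** Averaging kernels averages the images of the joint law. *)
Lemma joint_average E : measurable E ->
  joint pi Q E = \int[rho]_w joint pi P (shear (u w) (v w) @^-1` E).
Proof.
move=> mE; rewrite jointE.
pose f (xw : X * W) := twist a P (u xw.2) (v xw.2) xw.1 (xsection E xw.1).
have mf : measurable_fun setT f.
  pose E' := [set q : (X * W) * X | E (q.1.1, a (v q.1.2) q.2)].
  have mE' : measurable E'.
    rewrite -[X in measurable X]setTI.
    have mq : measurable_fun setT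
        (fun q : (X * W) * X => (q.1.1, a (v q.1.2) q.2)).
      apply: measurable_fun_pair; first exact: measurableT_comp.
      apply: measurable_act_comp => //; apply: (measurableT_comp v_meas).
      exact: measurableT_comp.
    exact: mq.
  have mux : measurable_fun setT (fun xw : X * W => a (u xw.2) xw.1).
    by apply: measurable_act_comp => //; exact: (measurableT_comp u_meas).
  rewrite (_ : f = fun xw => P (a (u xw.2) xw.1) (xsection E' xw)).
    exact: measurable_kernel_xsection.
  by apply/funext => xw; rewrite /f /twist translateVE.
transitivity (\int[pi]_x \int[rho]_w f (x, w)).
  by apply: eq_integral => x _; rewrite Q_avg//; exact: measurable_xsection.
by rewrite fubini_tonelli//; apply: eq_integral => w _; rewrite joint_shear.
Qed.

Variable F : (set X)^nat.
Hypotheses (FE : measurable = <<s range F >>) (FI : setI_closed (range F))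
  (FT : range F setT).
Hypotheses (Q_fix : forall w x A, measurable A -> Q x A = twist a Q (u w) (v w) x A)
  (M_fix : forall w x A, measurable A -> M x A = twist a M (u w) (v w) x A).

(** The joint laws of [P], [Q] and [M] are in the situation of
    [mixture_lne_rn] as soon as that of [P] is dominated by that of [M].
    Otherwise the left-hand side is infinite; domination being transitive, one
    of the terms on the right is infinite as well, and neither is [-oo]. *)
Lemma kl_divergence_average :
  kl_divergence pi P M = kl_divergence pi P Q + kl_divergence pi Q M.
Proof.
have Q_inv w E := @joint_fixed Q (u w) (v w) E (Q_fix w).
have M_inv w E := @joint_fixed M (u w) (v w) E (M_fix w).
have mS w := measurable_shear (u w) (v w).
have mS' w := measurable_shear (u w)^-1%g (v w)^-1%g.
have SK w := @shearK (u w) (v w).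
have [PM|PM] := pselect (joint pi P `<< joint pi M).
  have QM := mixture_dominated mS joint_average M_inv PM.
  have PQ := mixture_dominates mS mS' SK joint_average Q_inv M_inv PM.
  rewrite !(kl_divergence_joint FE FI FT)//.
  exact: (mixture_lne_rn mS mS' SK joint_average Q_inv M_inv).
rewrite [LHS]kl_divergence_pinfty//.
have := kl_divergence_neqNy pi FE FI FT P Q.
have := kl_divergence_neqNy pi FE FI FT Q M.
have [PQ|PQ] := pselect (joint pi P `<< joint pi Q); last first.
  by rewrite (kl_divergence_pinfty PQ) => ? _; rewrite addye.
move=> _ PQNy; rewrite [X in _ + X]kl_divergence_pinfty ?addey// => QM.
by apply: PM; exact: null_dominates_trans PQ QM.
Qed.

End measurable_actions.

(** * Borel sets of a Polish space *)

Lemma separable_second_countable (R : realType) (X : pseudoMetricType R)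
    (D : set X) : countable D -> dense D -> @second_countable X.
Proof.
move=> cD dD; pose f (xn : X * nat) : set X := (ball xn.1 xn.2.+1%:R^-1)°.
exists (f @` (D `*` setT)); first exact: (card_le_trans (card_image_le f _) (countableX cD _)).
split; first by move=> _ [xn _ <-]; exact: open_interior.
move=> x V /nbhs_ballP[e /= e0 xV].
(* with r := 1 / (n + 1), a point y of D within r / 2 of x gives the basic set
   ball y r, a neighbourhood of x contained in ball x (3 r / 2) *)
have [n ne] : exists n, (0 + n.+1%:R^-1 < e / 2)%R.
  by apply: ltr_add_invr; rewrite divr_gt0.
set r : R := n.+1%:R^-1%R in ne; have r0 : (0 < r :> R)%R by rewrite invr_gt0.
have [y [/interior_subset xy Dy]] : (ball x (r / 2))° `&` D !=set0.
  apply: dD; last exact: open_interior.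
  by exists x; apply: nbhsx_ballx; rewrite divr_gt0.
have xy_sub : ball x (r / 2) `<=` ball y r.
  by move=> z xz; rewrite (splitr r); exact: ball_triangle (ball_sym xy) xz.
exists (f (y, n)) => /=.
  split; first by exists (y, n).
  by apply: (filterS xy_sub); apply: nbhsx_ballx; rewrite divr_gt0.
apply: subset_trans xV => z /interior_subset yz.
apply: (le_ball _ (ball_triangle xy yz)).
rewrite add0r in ne; rewrite (splitr e) lerD// ltW//.
by apply: le_lt_trans ne; rewrite ler_pdivrMr// ler_peMr ?ltW// ltr1n.
Qed.

(** The finite intersections of basic open sets form a countable pi-system, and
    every open set is a countable union of basic ones. *)
Lemma second_countable_borel (X : ptopologicalType) : @second_countable X ->
  exists F : (set (borel X))^nat,
    [/\ measurable = <<s range F >>, setI_closed (range F) & range F setT].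
Proof.
case=> B cB [Bo Bb]; pose C : set (set X) := finI_from B id.
have CT : C setT.
  by exists finmap.fset0 => //; rewrite set_fset0 bigcap_set0.
have cC : countable C by exact: finI_from_countable.
have [F CE] : exists F : (set X)^nat, range F = C.
  have [C0|[F]] := pfcard_geP cC; first by move: CT; rewrite C0.
  exists F; apply/seteqP; split => [_ [n _ <-]|A CA]; [exact: funS|exact: surj].
exists F; rewrite CE; split => //; last by move=> ? ? ? ?; exact: finI_fromI.
apply/seteqP; split.
  apply: smallest_sub; first exact: smallest_sigma_algebra.
  move=> U Uo.
  rewrite (_ : U = \bigcup_n (if `[< F n `<=` U >] then F n else set0)).
    apply: sigma_algebra_bigcup => n; case: ifPn => _; last exact: sigma_algebra0.
    by apply: sub_sigma_algebra; rewrite -CE; exists n.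
  apply/seteqP; split => [x Ux|x [n _]]; last by case: asboolP => // /[apply].
  have [V [BV Vx] VU] := Bb x U (open_nbhs_nbhs (conj Uo Ux)).
  have [n _ Fn] : range F V by rewrite CE; exact: finI_from1.
  by exists n => //; rewrite Fn; case: asboolP.
apply: smallest_sub; first exact: smallest_sigma_algebra.
move=> _ [E EB <-]; apply: (@fin_bigcap_measurable _ (borel X)).
  exact: finite_fset.
by move=> A /EB /set_mem /Bo; exact: sub_sigma_algebra.
Qed.

(** * Right invariance of a Haar probability *)

Section haar_integral.
Context (R : realType) (G : topologicalGroupType) (mu : probability (borel G) R).
Hypothesis mu_mulg : forall (g : G) (A : set (borel G)), measurable A ->
  mu [set (g * x)%g | x in A] = mu A.
Implicit Types F : borel G -> \bar R.

Lemma measurable_mulgl (g : G) :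
  measurable_fun [set: borel G] (fun x : G => (g * x)%g : borel G).
Proof.
apply: measurability => // _ [U oU <-]; rewrite setTI.
apply: sub_sigma_algebra; apply: open_comp oU => x _.
apply: (@continuous_comp _ _ _ (fun x => (g, x)) (fun gx : G * G => (gx.1 * gx.2)%g)).
  by apply: cvg_pair; [exact: cvg_cst|exact: cvg_id].
exact: continuous_mulg.
Qed.

Lemma haar_integral_mulgl F (g : G) : (forall x, 0 <= F x) -> measurable_fun setT F ->
  \int[mu]_x F (g * x)%g = \int[mu]_x F x.
Proof.
move=> F0 mF.
rewrite -[LHS](ge0_integral_pushforward (measurable_mulgl g) mu measurableT mF)//.
apply: eq_measure_integral => [|mg A mA _]; first exact: measurable_mulgl.
have mgA : measurable ((fun x : G => (g * x)%g : borel G) @^-1` A : set (borel G)).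
  by rewrite -[X in measurable X]setTI; exact: measurable_mulgl.
rewrite /= /pushforward -[LHS](mu_mulg g mgA); congr (mu _).
apply/seteqP; split => [_ [x Ax <-]//|x Ax].
by exists (g^-1 * x)%g => /=; rewrite mulgA mulgV mul1g.
Qed.

(** Both sides are values of the double integral of [F (x^-1 * y)]: integrate
    first in [y] by left invariance, or first in [x] after replacing [x] by
    [y * x].  The multiplication of [G] may fail to be measurable for
    the product of the Borel sigma-algebras, hence the hypothesis on [F]. *)
Lemma haar_integral_invg F : (forall x, 0 <= F x) -> measurable_fun setT F ->
  measurable_fun setT (fun t : borel G * borel G => F (t.1^-1 * t.2)%g) ->
  \int[mu]_x F x^-1%g = \int[mu]_x F x.
Proof.
move=> F0 mF mFM.
have cstE c : \int[mu]_x cst c x = c.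
  by rewrite integral_cst// [X in _ * X = _](_ : _ = 1) ?mule1//; exact: probability_setT.
transitivity (\int[mu]_y \int[mu]_x F (x^-1 * y)%g).
  rewrite [RHS](eq_integral (cst (\int[mu]_x F x^-1%g))) ?cstE// => y _.
  rewrite /= -(haar_integral_mulgl (F := fun x : G => F (x^-1 * y)%g) y)//.
    by apply: eq_integral => x _; rewrite invgM -mulgA mulVg mulg1.
  exact: (measurableT_comp mFM (measurable_pair2 (y : borel G))).
rewrite -[LHS](fubini_tonelli (fun t : borel G * borel G => F (t.1^-1 * t.2)%g) mFM)//=.
rewrite [LHS](eq_integral (cst (\int[mu]_x F x))) ?cstE// => x _.
exact: haar_integral_mulgl.
Qed.

(** Inversion exchanges left and right translations. *)
Lemma haar_integral_mulgr F (h : G) : (forall x, 0 <= F x) ->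
  (forall h, measurable_fun setT
    (fun t : borel G * borel G => F (t.1^-1 * t.2 * h)%g)) ->
  \int[mu]_x F (x * h)%g = \int[mu]_x F x.
Proof.
move=> F0 mF.
have mFr (k : G) : measurable_fun [set: borel G] (fun x : G => F (x * k)%g).
  have := measurableT_comp (mF k) (measurable_pair1 (1%g : borel G)).
  by apply: eq_measurable_fun => x _ /=; rewrite invg1 mul1g.
have mF1 : measurable_fun setT F.
  by apply: eq_measurable_fun (mFr 1%g) => x _; rewrite mulg1.
have mFM : measurable_fun setT (fun t : borel G * borel G => F (t.1^-1 * t.2)%g).
  by apply: eq_measurable_fun (mF 1%g) => x _; rewrite mulg1.
rewrite -(haar_integral_invg (F := fun x : G => F (x * h)%g))//.
rewrite -[RHS](haar_integral_invg)//.
rewrite -[RHS](haar_integral_mulgl (F := fun x : G => F x^-1%g) h^-1%g)//.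
  by apply: eq_integral => x _; rewrite invgM invgK.
have := measurableT_comp mFM (measurable_pair2 (1%g : borel G)).
by apply: eq_measurable_fun => x _ /=; rewrite mulg1.
Qed.

End haar_integral.

(** * Invariance of the averaged kernels *)

Section acting_families.
Context d d' (G : topologicalGroupType) (X : measurableType d)
  (T : measurableType d') (a : measurable_action G X).
Implicit Types s t : T -> G.

(** Weaker than measurability of [s] as a map to [G], and stable under products
    even when the multiplication of [G] is not measurable, since a product acts
    by composition; it is what the measurability of [twist] rests on. *)
Definition acts_measurably s :=
  measurable_fun [set: T * X] (fun z => a (s z.1) z.2).

Lemma measurable_acts (s : T -> borel G) : measurable_fun setT s ->
  acts_measurably s.
Proof. by move=> ms; apply: measurable_act_comp => //; exact: (measurableT_comp ms). Qed.

Lemma acts_cst (g : G) : acts_measurably (fun=> g).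
Proof. exact: (@measurable_acts (fun=> g)). Qed.

Lemma acts_mul s t : acts_measurably s -> acts_measurably t ->
  acts_measurably (fun x => s x * t x)%g.
Proof.
move=> ms mt.
have mz : measurable_fun setT (fun z : T * X => (z.1, a (t z.1) z.2)).
  exact: measurable_fun_pair.
by apply: eq_measurable_fun (measurableT_comp ms mz) => z _ /=; rewrite actM.
Qed.

Lemma measurable_twist (R : realType) (P : R.-pker X ~> X) s t x A :
  acts_measurably s -> acts_measurably t -> measurable A ->
  measurable_fun [set: T] (fun w => twist a P (s w) (t w) x A).
Proof.
move=> ms mt mA.
have msx : measurable_fun setT (fun w => a (s w) x).
  exact: (measurableT_comp ms (measurable_pair2 x)).
have mE : measurable ((fun z : T * X => a (t z.1) z.2) @^-1` A).
  by rewrite -[X in measurable X]setTI; exact: mt.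
apply: eq_measurable_fun (measurable_kernel_xsection P msx mE) => w _.
rewrite /twist translateVE; congr (P _ _).
by apply/seteqP; split => y; rewrite /xsection/= !inE.
Qed.

End acting_families.

Section twisted_kernels.
Context d (G : topologicalGroupType) (X : measurableType d) (R : realType).
Variables (a : measurable_action G X) (P : R.-pker X ~> X).

Lemma twist_twist g1 h1 g2 h2 x A :
  twist a P g1 h1 (a g2 x) (translate a h2^-1%g A) = twist a P (g1 * g2)%g (h2 * h1)%g x A.
Proof.
rewrite /twist !translateVE -actM; congr (P _ _).
by apply/seteqP; split => y /=; rewrite actM.
Qed.

Lemma twist_ge0 g h x A : 0 <= twist a P g h x A.
Proof. exact: measure_ge0. Qed.

Lemma measurable_translateV g A : measurable A -> measurable (translate a g^-1%g A).
Proof.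
by move=> mA; rewrite translateVE -[X in measurable X]setTI; exact: measurable_actl.
Qed.

Lemma fixed_both g h x A : left_invariant a P -> right_invariant a P ->
  measurable A -> P x A = twist a P g h x A.
Proof.
move=> lP rP mA; rewrite (rP h x A mA).
have mhA := measurable_translateV h mA.
rewrite {1}/twist act1 (lP g)// /twist.
by congr (P _ _); rewrite invg1 translate1.
Qed.

Variable mu : probability (borel G) R.
Hypothesis mu_mulg : forall (g : G) (A : set (borel G)), measurable A ->
  mu [set (g * x)%g | x in A] = mu A.

Let mfst : acts_measurably a (fun t : borel G * borel G => t.1 : G).
Proof. exact: (measurable_acts a measurable_fst). Qed.

Let mfstV : acts_measurably a (fun t : borel G * borel G => t.1^-1%g : G).
Proof. by apply: measurable_acts; exact: (measurableT_comp (measurable_invg (G := G))). Qed.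

Let msnd : acts_measurably a (fun t : borel G * borel G => t.2 : G).
Proof. exact: (measurable_acts a measurable_snd). Qed.

Let msndV : acts_measurably a (fun t : borel G * borel G => t.2^-1%g : G).
Proof. by apply: measurable_acts; exact: (measurableT_comp (measurable_invg (G := G))). Qed.

Let mid : acts_measurably a (fun g : borel G => g : G).
Proof. exact: (measurable_acts a (@measurable_id _ (borel G) setT)). Qed.

Let morbit h : acts_measurably a (fun t : borel G * borel G => t.1^-1 * t.2 * h)%g.
Proof. by apply: acts_mul; [exact: acts_mul|exact: acts_cst]. Qed.

Let morbitV h : acts_measurably a (fun t : borel G * borel G => (t.1^-1 * t.2 * h)^-1)%g.
Proof.
have -> : (fun t : borel G * borel G => (t.1^-1 * t.2 * h)^-1)%g =
    (fun t => h^-1 * (t.2^-1 * t.1))%g.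
  by apply/funext => t; rewrite !invgM invgK.
by apply: acts_mul; [exact: acts_cst|exact: acts_mul].
Qed.

(** Composing with [h] on the outside multiplies the integration variable by [h]
    on the right or on the left, and the Haar integral is invariant under both.
    The other averages are treated by the same computation. *)
Lemma bar_average_fixed h x A : measurable A ->
  bar_average a mu P x A = twist a (bar_average a mu P) h h^-1%g x A.
Proof.
move=> mA.
transitivity (\int[mu]_g twist a P (g * h)%g (g * h)^-1%g x A).
  apply/esym/(haar_integral_mulgr mu_mulg (F := fun g => twist a P g g^-1%g x A)).
    by move=> g; exact: twist_ge0.
  by move=> k; exact: measurable_twist.
by apply: eq_integral => g _; rewrite twist_twist invgM.
Qed.

Lemma tilde_average_fixed h x A : (forall g k : G, (g * k)%g = (k * g)%g) ->
  measurable A ->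
  tilde_average a mu P x A = twist a (tilde_average a mu P) h h x A.
Proof.
move=> GC mA.
transitivity (\int[mu]_g twist a P (h * g)%g (h * g)%g x A).
  apply/esym/(haar_integral_mulgl mu_mulg (F := fun g => twist a P g g x A)).
    by move=> g; exact: twist_ge0.
  exact: measurable_twist.
by apply: eq_integral => g _; rewrite twist_twist (GC g h).
Qed.

Lemma left_average_fixed h x A : measurable A ->
  left_average a mu P x A = twist a (left_average a mu P) h 1%g x A.
Proof.
move=> mA.
transitivity (\int[mu]_g twist a P (g * h)%g 1%g x A).
  apply/esym/(haar_integral_mulgr mu_mulg (F := fun g => twist a P g 1%g x A)).
    by move=> g; exact: twist_ge0.
  by move=> k; apply: measurable_twist => //; exact: acts_cst.
by apply: eq_integral => g _; rewrite twist_twist mulg1.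
Qed.

Lemma right_average_fixed h x A : measurable A ->
  right_average a mu P x A = twist a (right_average a mu P) 1%g h x A.
Proof.
move=> mA.
transitivity (\int[mu]_g twist a P 1%g (h * g)%g x A).
  apply/esym/(haar_integral_mulgl mu_mulg (F := fun g => twist a P 1%g g x A)).
    by move=> g; exact: twist_ge0.
  by apply: measurable_twist => //; exact: acts_cst.
by apply: eq_integral => g _; rewrite twist_twist mulg1.
Qed.

Let mtwist2 (s t : borel G * borel G -> G) x A : acts_measurably a s -> acts_measurably a t ->
  measurable A ->
  measurable_fun [set: borel G * borel G] (fun w => twist a P (s w) (t w) x A).
Proof. exact: measurable_twist. Qed.

Let left_right_iter x A : measurable A ->
  left_right_average a mu P x A = \int[mu]_g \int[mu]_h twist a P g h x A.
Proof.
move=> mA.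
rewrite [LHS](fubini_tonelli1 (fun t : borel G * borel G => twist a P t.1 t.2 x A))//.
exact: mtwist2.
Qed.

Lemma left_right_average_fixed g0 h0 x A : measurable A ->
  left_right_average a mu P x A = twist a (left_right_average a mu P) g0 h0 x A.
Proof.
move=> mA; rewrite /twist !left_right_iter//; last exact: measurable_translateV.
transitivity (\int[mu]_g \int[mu]_h twist a P (g * g0)%g h x A); last first.
  apply: eq_integral => g _.
  under [RHS]eq_integral do rewrite twist_twist.
  apply/esym/(haar_integral_mulgl mu_mulg (F := fun h => twist a P (g * g0)%g h x A)).
    by move=> h; exact: twist_ge0.
  by apply: measurable_twist => //; exact: acts_cst.
rewrite (fubini_tonelli (fun t : borel G * borel G => twist a P t.1 t.2 x A))//; last exact: mtwist2.
rewrite (fubini_tonelli (fun t : borel G * borel G => twist a P (t.1 * g0)%g t.2 x A))//; last first.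
  by apply: mtwist2 => //; apply: acts_mul => //; exact: acts_cst.
apply: eq_integral => h _ /=.
apply/esym/(haar_integral_mulgr mu_mulg (F := fun g => twist a P g h x A)).
  by move=> g; exact: twist_ge0.
by move=> k; apply: measurable_twist => //; exact: acts_cst.
Qed.

(** Here [g0] and [h0] multiply on the inner side, where [double_average] puts
    its twists; in [left_right_average_fixed] they multiply on the outer side. *)
Lemma left_right_average_shift g0 h0 x A : measurable A ->
  left_right_average a mu P x A = \int[mu]_g \int[mu]_h twist a P (g0 * g)%g (h * h0)%g x A.
Proof.
move=> mA; rewrite (left_right_iter x mA).
transitivity (\int[mu]_g \int[mu]_h twist a P g (h * h0)%g x A).
  apply: eq_integral => g _.
  apply/esym/(haar_integral_mulgr mu_mulg (F := fun h => twist a P g h x A)).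
    by move=> h; exact: twist_ge0.
  by move=> k; apply: measurable_twist => //; exact: acts_cst.
apply/esym/(haar_integral_mulgl mu_mulg (F := fun g => \int[mu]_h twist a P g (h * h0)%g x A)).
  by move=> g; apply: integral_ge0 => h _; exact: twist_ge0.
apply: (measurable_fun_fubini_tonelli_F (fun t : borel G * borel G => twist a P t.1 (t.2 * h0)%g x A)) => //.
by apply: mtwist2 => //; apply: acts_mul => //; exact: acts_cst.
Qed.

(** Averaging against Haar measure on both sides absorbs every earlier twist. *)
Lemma left_right_average_double (nu : probability (borel G * borel G)%type R) x A :
  measurable A -> left_right_average a mu P x A =
  \int[mu \x mu]_w twist a (double_average a nu P) w.1 w.2 x A.
Proof.
move=> mA.
pose f (z : (borel G * borel G) * (borel G * borel G)) :=
  twist a P (z.2.1 * z.1.1)%g (z.1.2 * z.2.2)%g x A.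
have mf : measurable_fun setT f.
  apply: measurable_twist => //; apply: acts_mul; apply: measurable_acts;
    by apply: measurableT_comp.
transitivity (\int[nu]_k \int[mu \x mu]_w f (w, k)).
  rewrite [RHS](eq_integral (cst (left_right_average a mu P x A))) => [|k _].
    rewrite integral_cst// [X in _ * X](_ : _ = 1) ?mule1//.
    exact: probability_setT.
  rewrite (left_right_average_shift k.1 k.2 x mA).
  rewrite (fubini_tonelli1 (fun w => f (w, k)))//.
  exact: (measurableT_comp mf (measurable_pair2 k)).
have f0 z : 0 <= f z by exact: twist_ge0.
have swap (mm : probability (borel G * borel G)%type R) :
    \int[nu]_k \int[mm]_w f (w, k) = \int[mm]_w \int[nu]_k f (w, k).
  exact/esym/(fubini_tonelli f mf f0).
rewrite [LHS](swap (mu \x mu)).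
apply: eq_integral => w _; by apply: eq_integral => k _; rewrite /f -twist_twist.
Qed.

End twisted_kernels.

(** * The six decompositions *)

Theorem corollary4p1 (R : realType)
    (G : topologicalGroupType) (hG : hausdorff_space G)
    (lcG : locally_compact [set: G])
    (X : completePseudoMetricType R) (polishX : polish_space X)
    (mu : probability (borel G) R) (haar_mu : haar_measure mu)
    (a : measurable_action G (borel X))
    (m : {measure set (borel X) -> \bar R})
    (m_inv : forall g : G,
      is_density (fun A => m (translate a g^-1%g A)) m (cst 1))
    (pi : probability (borel X) R) (pi_inv : invariant_measure a pi)
    (pi_dens : exists f, is_density pi m f)
    (P M : R.-pker (borel X) ~> (borel X))
    (P_dens : forall x, exists f, is_density (P x) m f)
    (M_dens : forall x, exists f, is_density (M x) m f)
    (nu : probability (borel G * borel G)%type R) :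
  let D := kl_divergence pi in
  let Pbar := bar_average a mu P in
  let Ptilde := tilde_average a mu P in
  let Pla := left_average a mu P in
  let Pra := right_average a mu P in
  let Plara := left_right_average a mu P in
  let Pda := double_average a nu P in
  (conj_invariant a M -> D P M = D P Pbar + D Pbar M) /\
  (left_invariant a M -> D P M = D P Pla + D Pla M) /\
  (right_invariant a M -> D P M = D P Pra + D Pra M) /\
  (left_invariant a M /\ right_invariant a M ->
    D P M = D P Plara + D Plara M) /\
  (left_invariant a M /\ right_invariant a M ->
    D Pda M = D Pda Plara + D Plara M) /\
  ((forall g h : G, (g * h)%g = (h * g)%g) ->
    diag_invariant a M -> D P M = D P Ptilde + D Ptilde M).
Proof.
have [D cD dD] := polishX.2.
have [F [FE FI FT]] := second_countable_borel (separable_second_countable cD dD).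
have pyth d' (W : measurableType d') (rho : probability W R) (u v : W -> borel G)
    (u_meas : measurable_fun setT u) (v_meas : measurable_fun setT v)
    (P' Q M' : R.-pker (borel X) ~> (borel X)) :=
  @kl_divergence_average _ _ _ _ a pi pi_inv _ W rho u v u_meas v_meas P' Q M'.
have mu_mulg := haar_mulg haar_mu.
have mid : measurable_fun [set: borel G] (fun g : borel G => g) by exact: measurable_id.
have mone : measurable_fun [set: borel G] (fun=> 1%g : borel G) by exact: measurable_cst.
split; [|split; [|split; [|split; [|split]]]].
- move=> Minv; apply: (pyth _ _ mu _ _ mid (@measurable_invg G)) FE FI FT _ _ => //.
  + by move=> g x A; exact: bar_average_fixed.
- move=> Minv; apply: (pyth _ _ mu _ _ mid mone) FE FI FT _ _ => //.
  + by move=> g x A; exact: left_average_fixed.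
- move=> Minv; apply: (pyth _ _ mu _ _ mone mid) FE FI FT _ _ => //.
  + by move=> g x A; exact: right_average_fixed.
- move=> [lM rM].
  apply: (pyth _ _ (mu \x mu) _ _ measurable_fst measurable_snd) FE FI FT _ _ => //.
  + by move=> gh x A; exact: left_right_average_fixed.
  + by move=> gh x A; exact: fixed_both.
- move=> [lM rM].
  apply: (pyth _ _ (mu \x mu) _ _ measurable_fst measurable_snd) FE FI FT _ _ => //.
  + by move=> x A; exact: left_right_average_double.
  + by move=> gh x A; exact: left_right_average_fixed.
  + by move=> gh x A; exact: fixed_both.
- move=> GC Minv; apply: (pyth _ _ mu _ _ mid mid) FE FI FT _ _ => //.
  + by move=> g x A; exact: tilde_average_fixed.
Qed.
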